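(* Suppose that: (A) each $f_i$ is convex, $L_i$-smooth for some $L_i>0$, and bounded from below, $h_i\equiv 0$ for all $i\in\mathcal V$, and the problem $\min_{x\in\mathbb{R}^d}\sum_{i\in\mathcal V}f_i(x)$ has a non-empty and bounded optimal solution set; (B) each $f_i$ is $\mu_i$-strongly convex for some $\mu_i>0$; (C) (total asynchrony) $\mathcal K_i$ is an infinite subset of $\mathbb{N}_0$ for each $i\in\mathcal V$, and $\lim_{k\to+\infty}s_{ij}^k=+\infty$ for all $i\in\mathcal V$ and $j\in\mathcal N_i$; (D) $\displaystyle\alpha\in\Bigl(0,\frac{2}{\max_{i\in\mathcal V}L_i}\Bigr)$. Then, for any initial point $\mathbf{x}^0\in\mathbb{R}^{nd}$, the sequence $\{\mathbf{x}^k\}$ generated by the asynchronous DGD-ATC converges to some fixed point of the synchronous DGD-ATC.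
   Context: $\mathcal G=(\mathcal V,\mathcal E)$ is an undirected connected graph with vertex set $\mathcal V=\{1,\dots,n\}$; $\mathcal E$ contains no self-loops; $\mathcal N_i=\{j:\{i,j\}\in\mathcal E\}$ and $\bar{\mathcal N}_i=\mathcal N_i\cup\{i\}$. For each $i\in\mathcal V$, $f_i:\mathbb{R}^d\to\mathbb{R}$ (the general problem has an additional term $h_i$ in each local cost, here zero). A differentiable function $f$ is $L$-smooth if $\|\nabla f(y)-\nabla f(x)\|\le L\|y-x\|$ for all $x,y$, and $\mu$-strongly convex if $\langle\nabla f(y)-\nabla f(x),y-x\rangle\ge\mu\|y-x\|^2$ for all $x,y$. For $\mathbf{x}=(x_1^T,\dots,x_n^T)^T\in\mathbb{R}^{nd}$ with $x_i\in\mathbb{R}^d$, put $f(\mathbf{x})=\sum_{i}f_i(x_i)$. $W=(w_{ij})\in\mathbb{R}^{n\times n}$ is a positive definite averaging matrix associated with $\mathcal G$: it is symmetric positive definite and doubly stochastic (non-negative, rows and columns sum to 1), and $w_{ij}>0$ if $\{i,j\}\in\mathcal E$ or $i=j$, $w_{ij}=0$ otherwise. $\mathbf{W}=W\otimes I_d$. Synchronous DGD-ATC with step-size $\alpha>0$: $\mathbf{x}^{k+1}=\mathbf{W}(\mathbf{x}^k-\alpha\nabla f(\mathbf{x}^k))$; a fixed point is $\mathbf{x}^\star$ with $\mathbf{x}^\star=\mathbf{W}(\mathbf{x}^\star-\alpha\nabla f(\mathbf{x}^\star))$. Asynchronous DGD-ATC with step-size $\alpha$: for each $i\in\mathcal V$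 and $k\in\mathbb{N}_0=\{0,1,2,\dots\}$, $$x_i^{k+1}=\begin{cases}\sum_{j\in\bar{\mathcal N}_i}w_{ij}\bigl(x_j^{s_{ij}^k}-\alpha\nabla f_j(x_j^{s_{ij}^k})\bigr),&k\in\mathcal K_i,\\ x_i^k,&\text{otherwise},\end{cases}$$ where $\mathcal K_i\subseteq\mathbb{N}_0$ is the set of iterations at which node $i$ updates, the integer $s_{ij}^k\in[0,k]$, $j\in\mathcal N_i$, is the iteration index of the most recent $y_j=x_j-\alpha\nabla f_j(x_j)$ that node $i$ has received from $j$, and $s_{ii}^k=k$. *)

(* Defs.v *)
From HB Require Import structures.
From mathcomp Require Import all_boot all_order all_algebra.
From mathcomp Require Import mxtens.
From mathcomp Require Import all_classical all_reals all_analysis.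
Import Order.TTheory GRing.Theory Num.Theory.
Import numFieldNormedType.Exports.

Set Implicit Arguments.
Unset Strict Implicit.
Unset Printing Implicit Defensive.

Local Open Scope classical_set_scope.
Local Open Scope ring_scope.

(* The library norm on matrices is the sup norm.  It is used only for the
   topology, differentiability and boundedness; the constants in smoothness
   and strong convexity refer to the Euclidean structure below. *)
Definition dotp (R : realType) (d : nat) (u v : 'rV[R]_d) : R :=
  \sum_(j < d) u 0 j * v 0 j.

Definition norm2 (R : realType) (d : nat) (u : 'rV[R]_d) : R :=
  Num.sqrt (dotp u u).

(* R^d is the case m = 1, and R^(nd) = (R^d)^n the case m = n. *)
Definition grad (R : realType) (m d : nat) (f : 'M[R]_(m, d) -> R)
    (x : 'M[R]_(m, d)) : 'M[R]_(m, d) :=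
  \matrix_(i, j) 'D_(delta_mx i j) f x.

Definition smooth (R : realType) (d : nat) (L : R) (f : 'rV[R]_d -> R) : Prop :=
  (forall x, differentiable f x) /\
  (forall x y, norm2 (grad f y - grad f x) <= L * norm2 (y - x)).

Definition strongly_convex (R : realType) (d : nat) (mu : R)
    (f : 'rV[R]_d -> R) : Prop :=
  (forall x, differentiable f x) /\
  (forall x y, mu * norm2 (y - x) ^+ 2 <= dotp (grad f y - grad f x) (y - x)).

Definition minimizers (R : realType) (d : nat) (F : 'rV[R]_d -> R) :
    set 'rV[R]_d :=
  [set x | forall y, F x <= F y].

Definition connected_graph (n : nat) (e : rel 'I_n) : Prop :=
  [/\ symmetric e, irreflexive e & forall i j, connect e i j].

Definition closed_nbh (n : nat) (e : rel 'I_n) (i : 'I_n) : {set 'I_n} :=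
  ([set j | e i j] :|: [set i])%SET.

Definition averaging_matrix (R : realType) (n : nat) (e : rel 'I_n)
    (W : 'M[R]_n) : Prop :=
  [/\ forall i j, 0 <= W i j,
      forall i, \sum_j W i j = 1,
      forall j, \sum_i W i j = 1,
      forall i j, e i j || (i == j) -> 0 < W i j &
      forall i j, ~~ (e i j || (i == j)) -> W i j = 0].

Definition posdef_mx (R : realType) (n : nat) (W : 'M[R]_n) : Prop :=
  W^T = W /\ forall v : 'rV[R]_n, v != 0 -> 0 < (v *m W *m v^T) 0 0.

(* A point of R^(nd) is stored as the n x d matrix whose i-th row is x_i^T;
   [stack] is the corresponding column vector (x_1^T, ..., x_n^T)^T.  Through
   it, left multiplication by W is the action of W ⊗ I_d. *)
Definition stack (R : realType) (n d : nat) (X : 'M[R]_(n, d)) :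
    'cV[R]_(n * d) :=
  \col_k X (mxtens_unindex k).1 (mxtens_unindex k).2.

Lemma stack_mulmx (R : realType) (n d : nat) (W : 'M[R]_n)
    (X : 'M[R]_(n, d)) :
  stack (W *m X) = (W *t (1%:M : 'M[R]_d)) *m stack X.
Proof.
apply/colP => k; rewrite !mxE.
rewrite (reindex (@mxtens_index n d)) /=; last first.
  by exists (@mxtens_unindex n d) => x _;
    rewrite ?mxtens_indexK ?mxtens_unindexK.
under [RHS]eq_bigr => p _ do rewrite !mxE !mxtens_indexK.
rewrite -(pair_bigA _ (fun l j => W (mxtens_unindex k).1 l *
  ((mxtens_unindex k).2 == j)%:R * X l j)) /=.
apply: eq_bigr => l _.
rewrite (bigD1 (mxtens_unindex k).2) //= big1 ?addr0; first by rewrite eqxx mulr1.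
by move=> j jk; rewrite eq_sym (negbTE jk) mulr0 mul0r.
Qed.

Definition total_cost (R : realType) (n d : nat) (f : 'I_n -> 'rV[R]_d -> R)
    (X : 'M[R]_(n, d)) : R :=
  \sum_(i < n) f i (row i X).

Definition sync_DGD_ATC (R : realType) (n d : nat) (W : 'M[R]_n) (alpha : R)
    (f : 'I_n -> 'rV[R]_d -> R) (X : 'M[R]_(n, d)) : 'M[R]_(n, d) :=
  W *m (X - alpha *: grad (total_cost f) X).

Definition sync_fixed_point (R : realType) (n d : nat) (W : 'M[R]_n)
    (alpha : R) (f : 'I_n -> 'rV[R]_d -> R) (X : 'M[R]_(n, d)) : Prop :=
  X = sync_DGD_ATC W alpha f X.

(* [s i j k] only matters for j in the closed neighbourhood of i. *)
Definition admissible_delays (n : nat) (e : rel 'I_n)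
    (s : 'I_n -> 'I_n -> nat -> nat) : Prop :=
  (forall i j k, e i j -> (s i j k <= k)%N) /\ (forall i k, s i i k = k).

Definition totally_asynchronous (n : nat) (e : rel 'I_n)
    (K : 'I_n -> set nat) (s : 'I_n -> 'I_n -> nat -> nat) : Prop :=
  (forall i, infinite_set (K i)) /\
  (forall i j, e i j -> s i j k @[k --> \oo] --> \oo).

Definition async_DGD_ATC (R : realType) (n d : nat) (e : rel 'I_n)
    (W : 'M[R]_n) (alpha : R) (f : 'I_n -> 'rV[R]_d -> R)
    (K : 'I_n -> set nat) (s : 'I_n -> 'I_n -> nat -> nat)
    (x : nat -> 'M[R]_(n, d)) : Prop :=
  forall (i : 'I_n) (k : nat),
    (K i k -> row i (x k.+1) =
       \sum_(j in closed_nbh e i)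
         W i j *: (row j (x (s i j k)) -
                   alpha *: grad (f j) (row j (x (s i j k))))) /\
    (~ K i k -> row i (x k.+1) = row i (x k)).

(* Main.v *)
(* For an L-smooth convex f the gradient is (1/L)-cocoercive, so for
   0 < a < 2/L and f strongly convex the gradient step x - a grad f(x) is a
   Euclidean contraction.  Since the rows of W are probability vectors, Jensen
   makes the synchronous iteration a contraction, with some factor r, for the
   largest squared Euclidean block norm; it has a fixed point by Banach.  For
   the asynchronous iteration, all block distances to the fixed point stay
   below their initial bound C, and once every delayed index is past the time
   from which the bound r^m C holds, each update of a block brings it below
   r^(m+1) C forever. *)

Require Import Defs.
From HB Require Import structures.
From mathcomp Require Import all_boot all_order all_algebra.
From mathcomp Require Import all_classical all_reals all_analysis.
From mathcomp Require Import ring lra.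
Import Order.TTheory GRing.Theory Num.Theory.
Import numFieldNormedType.Exports.

Set Implicit Arguments.
Unset Strict Implicit.
Unset Printing Implicit Defensive.

Local Open Scope classical_set_scope.
Local Open Scope ring_scope.

(* The library does not derive [completeNormedModType] for matrices, which
   [banach_fixed_point] needs; re-declaring completeness creates the join. *)
HB.instance Definition _ (R : realType) (m n : nat) :=
  Uniform_isComplete.Build 'M[R]_(m, n) (@mx_complete R m n).

(** * The Euclidean inner product on row vectors *)

Section EuclideanStructure.
Context {R : realType} {d : nat}.
Implicit Types (u v w : 'rV[R]_d) (c : R).

Lemma dotpC u v : dotp u v = dotp v u.
Proof. by apply: eq_bigr => j _; rewrite mulrC. Qed.

Lemma dotpDl u v w : dotp (u + v) w = dotp u w + dotp v w.
Proof. by rewrite -big_split; apply: eq_bigr => j _; rewrite mxE mulrDl. Qed.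

Lemma dotpZl c u v : dotp (c *: u) v = c * dotp u v.
Proof. by rewrite mulr_sumr; apply: eq_bigr => j _; rewrite mxE mulrA. Qed.

Lemma dotpBl u v w : dotp (u - v) w = dotp u w - dotp v w.
Proof. by rewrite dotpDl -scaleN1r dotpZl mulN1r. Qed.

Lemma dotpDr u v w : dotp u (v + w) = dotp u v + dotp u w.
Proof. by rewrite !(dotpC u) dotpDl. Qed.

Lemma dotpZr c u v : dotp u (c *: v) = c * dotp u v.
Proof. by rewrite !(dotpC u) dotpZl. Qed.

Lemma dotpBr u v w : dotp u (v - w) = dotp u v - dotp u w.
Proof. by rewrite !(dotpC u) dotpBl. Qed.

Lemma dotp0l u : dotp 0 u = 0.
Proof. by rewrite -(scale0r 0) dotpZl mul0r. Qed.

Lemma dotp_ge0 u : 0 <= dotp u u.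
Proof. by apply: sumr_ge0 => j _; rewrite -expr2 sqr_ge0. Qed.

Lemma norm2_sqr u : norm2 u ^+ 2 = dotp u u.
Proof. exact/sqr_sqrtr/dotp_ge0. Qed.

Lemma dotpBZ c u v :
  dotp (u - c *: v) (u - c *: v) =
  dotp u u - 2 * c * dotp u v + c ^+ 2 * dotp v v.
Proof. rewrite dotpBl !dotpBr !dotpZl !dotpZr (dotpC v u); ring. Qed.

(** Stands in for Cauchy-Schwarz: expanding [0 <= |u - c v|^2] gives [2 c <u, v> <= |u|^2 + c^2
    |v|^2 <= 2 c^2 |v|^2]. *)
Lemma dotp_le_scale c u v :
  0 < c -> dotp u u <= c ^+ 2 * dotp v v -> dotp u v <= c * dotp v v.
Proof.
move=> c0 uv; have := dotp_ge0 (u - c *: v).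
rewrite dotpBZ => h; rewrite -(ler_pM2l c0); lra.
Qed.

Lemma sqr_entry_le_dotp u j : u 0 j ^+ 2 <= dotp u u.
Proof.
rewrite /dotp (bigD1 j)//= -expr2 lerDl sumr_ge0// => k _.
by rewrite -expr2 sqr_ge0.
Qed.

Lemma dotp_le_norm u : dotp u u <= d%:R * `|u| ^+ 2.
Proof.
rewrite -[d in d%:R]card_ord mulr_natl -sumr_const; apply: ler_sum => j _.
rewrite -expr2 -real_normK ?num_real// ler_sqr ?nnegrE//.
by rewrite [leRHS]/Num.norm/= mx_normrE (le_bigmax _ _ (0, j)).
Qed.

(** The gap between the two sides is the variance of [u] under the weights [p], a sum of nonnegative
    terms. *)
Lemma dotp_convex_sum (I : finType) (p : I -> R) (u : I -> 'rV[R]_d) :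
  (forall i, 0 <= p i) -> \sum_i p i = 1 ->
  dotp (\sum_i p i *: u i) (\sum_i p i *: u i) <=
    \sum_i p i * dotp (u i) (u i).
Proof.
move=> p0 p1; set m := \sum_i _ *: _.
have : 0 <= \sum_i p i * dotp (u i - m) (u i - m).
  by apply: sumr_ge0 => i _; rewrite mulr_ge0 ?dotp_ge0.
have -> : \sum_i p i * dotp (u i - m) (u i - m) =
    \sum_i p i * dotp (u i) (u i) - dotp m m.
  have mE : dotp m m = \sum_i p i * dotp (u i) m.
    rewrite {1}/m; transitivity (\sum_i dotp (p i *: u i) m).
      rewrite (big_morph (fun x => dotp x m) (id1 := 0) (op1 := +%R))//.
        by move=> x y; exact: dotpDl.
      by rewrite /dotp big1// => j _; rewrite mxE mul0r.
    by apply: eq_bigr => i _; rewrite dotpZl.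
  rewrite (eq_bigr (fun i => p i * dotp (u i) (u i) - p i * dotp (u i) m -
      (p i * dotp (u i) m - p i * dotp m m))); last first.
    by move=> i _; rewrite dotpBl !dotpBr (dotpC m (u i)); ring.
  by rewrite !sumrB -mE -mulr_suml p1 mul1r subrr subr0.
by rewrite subr_ge0.
Qed.

End EuclideanStructure.

Lemma mx_norm_leP (R : realType) (m n : nat) (A : 'M[R]_(m, n)) (c : R) :
  0 <= c -> reflect (forall i j, `|A i j| <= c) (`|A| <= c).
Proof.
move=> c0; rewrite [`|A|]mx_normrE.
apply: (iffP idP) => [/bigmax_leP[_ h] i j|h]; first exact: (h (i, j)).
by apply/bigmax_leP; split=> // -[i j] _; exact: h.
Qed.

Lemma infinite_nat_ge (A : set nat) (N : nat) :
  infinite_set A -> exists2 k, A k & (N <= k)%N.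
Proof.
move=> infA; apply: contrapT => noA; apply: infA.
apply: sub_finite_set (finite_II N) => k Ak /=.
by rewrite ltnNge; apply/negP => Nk; apply: noA; exists k.
Qed.

(** The difference quotients themselves agree: perturbing an entry of row [i] leaves the other
    summands unchanged, so they cancel. *)
Lemma row_grad_total_cost (R : realType) (n d : nat)
    (f : 'I_n -> 'rV[R]_d -> R) (X : 'M[R]_(n, d)) (i : 'I_n) :
  row i (grad (total_cost f) X) = grad (f i) (row i X).
Proof.
apply/rowP => j; rewrite !mxE /derive; set F := (fun _ => _); set G := (fun _ => _).
suff -> : F = G by []; apply/funext => h; rewrite /F /G /=; congr (_ *: _).
rewrite /total_cost -sumrB (bigD1 i)//= big1 ?addr0 => [|l /negPf li].
  congr (f i _ - _); apply/rowP => k.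
  by rewrite !mxE !eqxx.
apply/eqP; rewrite subr_eq0; apply/eqP; congr (f l _).
by apply/rowP => k; rewrite !mxE li mulr0 add0r.
Qed.

(** * Cocoercivity of the gradient and contraction of the gradient step *)

Section ConvexSmooth.
Context {R : realType} {d : nat}.
Variable f : 'rV[R]_d -> R.
Hypothesis df : forall x, differentiable f x.
Implicit Types (x y v : 'rV[R]_d).

Lemma derive_dotp_grad x v : 'D_v f x = dotp (grad f x) v.
Proof.
rewrite deriveE// [in LHS](row_sum_delta v) linear_sum; apply: eq_bigr => j _.
by rewrite linearZ/= mxE deriveE// mulrC.
Qed.

Lemma is_derive_segment x v (t : R) :
  is_derive t 1 (fun s : R => f (s *: v + x)) (dotp (grad f (t *: v + x)) v).
Proof.
rewrite -derive_dotp_grad.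
have E : (fun h : R => h^-1 *: (((fun s : R => f (s *: v + x)) \o shift t)
      (h *: 1) - f (t *: v + x))) =
    (fun h => h^-1 *: ((f \o shift (t *: v + x)) (h *: v) - f (t *: v + x))).
  by apply/funext => h /=; rewrite scalerDl [h *: 1]mulr1 addrA.
apply: DeriveDef; last by rewrite /derive E.
by rewrite /derivable E; exact: diff_derivable.
Qed.

(* The mean value theorem for s |-> f (s v + x) + c (s - s^2); the correction
   vanishes at both ends, and c = L/2 |v|^2 yields the sharp constant in
   [descent]. *)
Lemma mean_value_segment (c : R) x v : exists2 t : R, 0 <= t <= 1 &
  f (v + x) - f x = dotp (grad f (t *: v + x)) v + c * (1 - 2 * t).
Proof.
pose g := (fun s : R => f (s *: v + x)) + (fun s : R => c * (s - s ^+ 2)).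
have dg (t : R) : is_derive t 1 g
    (dotp (grad f (t *: v + x)) v + c * (1 - 2 * t)).
  apply: is_deriveD; first exact: is_derive_segment.
  (* Written as a polynomial, the correction can be differentiated formally. *)
  have -> : (fun u : R => c * (u - u ^+ 2)) = horner (c *: ('X - 'X^2)).
    by apply/funext => u; rewrite !hornerE.
  apply: is_derive_eq; rewrite derivZ derivB derivX derivXn.
  by rewrite !hornerE; ring.
have gc : {within `[0, 1], continuous g}.
  by apply: derivable_within_continuous => t _; exact: ex_derive.
have [t] := MVT_segment ler01 (fun t _ => dg t) gc.
rewrite in_itv/= subr0 mulr1 => t01 gE; exists t => //.
rewrite -gE /g !fctE/= scale1r scale0r add0r; ring.
Qed.

Lemma descent (L : R) x v : 0 < L ->
  (forall y, norm2 (grad f y - grad f x) <= L * norm2 (y - x)) ->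
  f (v + x) - f x <= dotp (grad f x) v + L / 2 * dotp v v.
Proof.
move=> L0 fL.
have [t /andP[t0 _] ->] := mean_value_segment (L / 2 * dotp v v) x v.
(* The correction contributes [L / 2 * (1 - 2 * t) * |v|^2], whose part in [t] cancels this bound
   exactly, wherever [t] lies. *)
suff : dotp (grad f (t *: v + x) - grad f x) v <= L * t * dotp v v.
  by rewrite dotpBl; lra.
have [t_gt0|t_le0] := ltP 0 t; last first.
  have -> : t = 0 by lra.
  by rewrite scale0r add0r subrr dotp0l mulr0 mul0r.
apply: dotp_le_scale; first exact: mulr_gt0.
have := fL (t *: v + x); rewrite addrK -ler_sqr ?nnegrE ?mulr_ge0 ?sqrtr_ge0 ?(ltW L0)//.
by rewrite exprMn !norm2_sqr dotpZl dotpZr; lra.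
Qed.

Lemma monotone_grad_above_tangent x v :
  (forall y, 0 <= dotp (grad f y - grad f x) (y - x)) ->
  dotp (grad f x) v <= f (v + x) - f x.
Proof.
move=> fmono; have [t /andP[t0 _] ->] := mean_value_segment 0 x v.
rewrite mul0r addr0 -subr_ge0 -dotpBl.
have := fmono (t *: v + x).
(* The displacement is [t *: v], so a positive factor [t] can be divided out; for [t = 0] both
   gradients coincide. *)
rewrite addrK dotpZr; have [t_gt0|t_le0 _] := ltP 0 t; first by rewrite pmulr_rge0.
have -> : t = 0 by lra.
by rewrite scale0r add0r subrr dotp0l.
Qed.

(** By [half], the Bregman divergence of [f] is at least [|g|^2 / (2 L)], with [g] the gradient
    difference. Adding this for both orders of the points cancels the function values and leaves
    [<g, y - x>]. *)
Lemma cocoercive (L : R) : 0 < L ->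
  (forall x y, norm2 (grad f y - grad f x) <= L * norm2 (y - x)) ->
  (forall x y, 0 <= dotp (grad f y - grad f x) (y - x)) ->
  forall x y, dotp (grad f y - grad f x) (grad f y - grad f x) <=
    L * dotp (grad f y - grad f x) (y - x).
Proof.
move=> L0 fL fmono.
have half x y : dotp (grad f y - grad f x) (grad f y - grad f x) <=
    2 * L * (f y - f x - dotp (grad f x) (y - x)).
  (* compare f (y - g / L) from above at y and from below at x *)
  set g := grad f y - grad f x; set v := - (L^-1 *: g).
  have := @descent L y v L0 (fL y).
  have := @monotone_grad_above_tangent x (v + y - x) (fmono x).
  rewrite subrK {}/v -scaleNr -[_ + y - x]addrA (dotpDr _ _ (y - x)) !dotpZr !dotpZl.
  have -> : L / 2 * (- L^-1 * (- L^-1 * dotp g g)) = L^-1 * dotp g g / 2.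
    by field; rewrite lt0r_neq0.
  have -> : dotp g g = dotp (grad f y) g - dotp (grad f x) g by rewrite -dotpBl.
  by rewrite -ler_pdivrMl ?mulr_gt0// invfM; lra.
move=> x y; have := half x y; have := half y x.
set g := grad f y - grad f x; set v := y - x.
have -> : grad f x - grad f y = - 1 *: g by rewrite scaleN1r opprB.
have -> : x - y = - 1 *: v by rewrite scaleN1r opprB.
have := dotpBl (grad f y) (grad f x) v.
rewrite -/g dotpZl !dotpZr => gvE h1 h2.
have : 2 * dotp g g <= 2 * L * dotp g v by rewrite gvE; lra.
by rewrite -mulrA ler_pM2l.
Qed.

(** In [|v - a g|^2 = |v|^2 - 2 a <g, v> + a^2 |g|^2], cocoercivity absorbs the last term into the
    middle one, leaving [- a (2 - a L) <g, v>], to which strong convexity applies. *)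
Lemma gradient_step_contraction (L mu a : R) :
  0 < L -> 0 < mu -> 0 <= a -> a * L <= 2 -> smooth L f -> strongly_convex mu f ->
  forall x y,
    dotp ((y - a *: grad f y) - (x - a *: grad f x))
         ((y - a *: grad f y) - (x - a *: grad f x)) <=
    (1 - a * (2 - a * L) * mu) * dotp (y - x) (y - x).
Proof.
move=> L0 mu0 a0 aL [_ fL] [_ fmu] x y.
have fmu' u w : mu * dotp (w - u) (w - u) <= dotp (grad f w - grad f u) (w - u).
  by rewrite -norm2_sqr.
have fmono u w : 0 <= dotp (grad f w - grad f u) (w - u).
  by rewrite (le_trans _ (fmu' u w))// mulr_ge0 ?dotp_ge0// ltW.
have := cocoercive L0 fL fmono x y; have := fmu' x y.
have -> : (y - a *: grad f y) - (x - a *: grad f x) =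
    (y - x) - a *: (grad f y - grad f x).
  by rewrite scalerBr !opprB addrACA [- _ - _]addrC addrACA.
set g := grad f y - _; set v := y - x.
rewrite dotpBZ (dotpC v g) => h1 h2.
have : a ^+ 2 * dotp g g <= a ^+ 2 * (L * dotp g v) by rewrite ler_wpM2l ?sqr_ge0.
have : a * (2 - a * L) * (mu * dotp v v) <= a * (2 - a * L) * dotp g v.
  by rewrite ler_wpM2l// mulr_ge0// subr_ge0.
lra.
Qed.

End ConvexSmooth.

(** * Averaged block contractions: fixed point and asynchronous iteration *)

Section BlockContraction.
Context {R : realType} {n d : nat}.
Variables (W : 'M[R]_n) (T : 'I_n -> 'rV[R]_d -> 'rV[R]_d) (r : R).
Hypothesis W_ge0 : forall i j, 0 <= W i j.
Hypothesis W_sum1 : forall i, \sum_j W i j = 1.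
Hypothesis r01 : 0 <= r < 1.
Hypothesis T_contr : forall j x y,
  dotp (T j y - T j x) (T j y - T j x) <= r * dotp (y - x) (y - x).

Let mix (u : 'I_n -> 'rV[R]_d) (i : 'I_n) := \sum_j W i j *: T j (u j).
Let F (X : 'M[R]_(n, d)) := \matrix_i mix (fun j => row j X) i.

(** The bound is asked only where the weight is nonzero, since delays are controlled only there. *)
Lemma mix_contraction (u v : 'I_n -> 'rV[R]_d) (i : 'I_n) (C : R) :
  (forall j, W i j != 0 -> dotp (u j - v j) (u j - v j) <= C) ->
  dotp (mix u i - mix v i) (mix u i - mix v i) <= r * C.
Proof.
move=> uvC; rewrite /mix -sumrB.
under eq_bigr => j _ do rewrite -scalerBr.
apply: (le_trans (dotp_convex_sum (fun j => T j (u j) - T j (v j))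
  (W_ge0 i) (W_sum1 i))).
rewrite -[leRHS]mul1r -(W_sum1 i) mulr_suml; apply: ler_sum => j _.
have [->|Wij] := eqVneq (W i j) 0; first by rewrite !mul0r.
rewrite ler_wpM2l//; apply: le_trans (T_contr _ _ _) _.
by case/andP: r01 => r0 _; rewrite ler_wpM2l ?uvC.
Qed.

Lemma iter_block_contraction (X Y : 'M[R]_(n, d)) (C : R) (m : nat) :
  (forall i, dotp (row i X - row i Y) (row i X - row i Y) <= C) ->
  forall i, dotp (row i (iter m F X) - row i (iter m F Y))
                 (row i (iter m F X) - row i (iter m F Y)) <= r ^+ m * C.
Proof.
move=> XYC; elim: m => [|m IH] i; first by rewrite expr0 mul1r.
by rewrite /= !rowK exprS -mulrA; apply: mix_contraction.
Qed.

(* The library norm is the sup norm, for which a single step need not contract. *)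
Lemma iter_sup_contraction : exists m, forall X Y : 'M[R]_(n, d),
  `|iter m F X - iter m F Y| <= 2^-1 * `|X - Y|.
Proof.
case/andP: r01 => r0 r1.
(* [d] is the price of bounding the squared Euclidean norm by the squared sup norm; [4^-1] is the
   square of the target factor [2^-1]. *)
have [m rm] : exists m, r ^+ m * d%:R <= 4^-1.
  have := @cvg_geometric R d%:R r; rewrite ger0_norm// => /(_ r1).
  move/cvgrPdist_lt => /(_ 4^-1); rewrite invr_gt0 ltr0n => /(_ isT)[m _ rm].
  exists m; have /ltW := rm m (leqnn m).
  by rewrite /= sub0r normrN mulrC; apply: le_trans; exact: ler_norm.
exists m => X Y; apply/mx_norm_leP => [|i j]; first by rewrite mulr_ge0 ?invr_ge0.
rewrite -ler_sqr ?nnegrE ?mulr_ge0 ?invr_ge0// real_normK ?num_real//.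
set D := iter m F X - iter m F Y.
have -> : D i j = (row i (iter m F X) - row i (iter m F Y)) 0 j by rewrite !mxE.
apply: le_trans (sqr_entry_le_dotp _ _) _.
apply: le_trans (@iter_block_contraction X Y (d%:R * `|X - Y| ^+ 2) m _ i) _.
  move=> k; apply: le_trans (dotp_le_norm _) _.
  rewrite ler_wpM2l// ler_sqr ?nnegrE//; apply/mx_norm_leP => // a b.
  have -> : (row k X - row k Y) a b = (X - Y) k b by rewrite !mxE.
  exact: (elimT (mx_norm_leP (X - Y) (normr_ge0 _))).
rewrite mulrA exprMn ler_wpM2r ?sqr_ge0//; apply: le_trans rm _; lra.
Qed.

(** Banach applies to an iterate of [F]. As [F] commutes with it, [F X] is again a fixed point of
    the iterate, and uniqueness gives [X = F X]. *)
Lemma block_contraction_fixed_point : exists X, X = F X.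
Proof.
have [m Fm] := iter_sup_contraction.
pose G : {fun [set: 'M[R]_(n, d)] >-> [set: 'M[R]_(n, d)]} :=
  [fun of totalfun (iter m F)].
have Gc : is_contraction G.
  exists 2^-1%:nng; split=> [|[x y] _]; last exact: Fm.
  by rewrite /= invf_lt1// ltr1n.
have [X _ XE] := banach_fixed_point Gc closedT (ex_intro _ 0 I).
exists X; apply: (contraction_fixpoint_unique Gc) => //.
by rewrite {1}XE /= /totalfun_ -iterSr iterS.
Qed.

Lemma async_geometric_bound (K : 'I_n -> set nat)
    (s : 'I_n -> 'I_n -> nat -> nat) (x : nat -> 'M[R]_(n, d))
    (xs : 'M[R]_(n, d)) :
  (forall i, infinite_set (K i)) ->
  (forall i j k, W i j != 0 -> (s i j k <= k)%N) ->
  (forall i j, W i j != 0 -> s i j k @[k --> \oo] --> \oo) ->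
  (forall i k, K i k -> row i (x k.+1) = mix (fun j => row j (x (s i j k))) i) ->
  (forall i k, ~ K i k -> row i (x k.+1) = row i (x k)) ->
  xs = F xs ->
  exists C, forall m, \forall k \near \oo, forall i,
    dotp (row i (x k) - row i xs) (row i (x k) - row i xs) <= r ^+ m * C.
Proof.
move=> Kinf sle soo xK xNK xsF; case/andP: r01 => r0 r1.
have rowxs i : row i xs = mix (fun j => row j xs) i by rewrite {1}xsF rowK.
pose D k i := dotp (row i (x k) - row i xs) (row i (x k) - row i xs).
have D0 k i : 0 <= D k i by exact: dotp_ge0.
have DK C i k : K i k -> (forall j, W i j != 0 -> D (s i j k) j <= C) ->
    D k.+1 i <= r * C.
  by move=> Kik h; rewrite /D xK// rowxs; exact: mix_contraction.
have DNK i k : ~ K i k -> D k.+1 i = D k i by move=> ?; rewrite /D xNK.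
pose C := \sum_i D 0%N i.
have C0 : 0 <= C by exact: sumr_ge0.
have bounded k i : D k i <= C.
  (* Strong induction, because an update may read arbitrarily old iterates. *)
  elim/ltn_ind: k i => -[_ i|k IH i].
    by rewrite /C (bigD1 i)//= lerDl sumr_ge0.
  have [Kik|/DNK->] := pselect (K i k); last exact: IH.
  apply: le_trans (DK C _ _ Kik _) _; last by rewrite ler_piMl// ltW.
  by move=> j Wij; apply: IH; rewrite ltnS sle.
exists C; elim=> [|m [N _ IH]].
  by apply: nearW => k i; rewrite expr0 mul1r; exact: bounded.
have [M _ late] : \forall k \near \oo, forall i j, W i j != 0 -> (N <= s i j k)%N.
  apply: filter_forall => i; apply: filter_forall => j.
  have [_|Wij] := eqVneq (W i j) 0; first exact: nearW.
  by have /cvgnyPge/(_ N) := soo i j Wij; apply: filterS.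
(* There are finitely many blocks, so each may have its own threshold: one step after its first
   chosen update [k0] past [M]. *)
apply: filter_forall => i.
have [k0 Kk0 k0M] := infinite_nat_ge M (Kinf i).
exists k0.+1 => // k /=; elim: k => // k IHk; rewrite ltnS leq_eqVlt.
have step k' : K i k' -> (k0 <= k')%N -> D k'.+1 i <= r ^+ m.+1 * C.
  move=> Kk k0k; rewrite exprS -mulrA; apply: DK => // j Wij.
  by apply: IH => /=; apply: late => //=; exact: leq_trans k0k.
case/orP => [/eqP <-|k0k]; first exact: step.
have [Kik|/DNK Dk] := pselect (K i k); first by apply: step => //; exact: ltnW.
by rewrite -/(D _ _) Dk; exact: IHk.
Qed.

Lemma async_iterates_cvg (K : 'I_n -> set nat)
    (s : 'I_n -> 'I_n -> nat -> nat) (x : nat -> 'M[R]_(n, d))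
    (xs : 'M[R]_(n, d)) :
  (forall i, infinite_set (K i)) ->
  (forall i j k, W i j != 0 -> (s i j k <= k)%N) ->
  (forall i j, W i j != 0 -> s i j k @[k --> \oo] --> \oo) ->
  (forall i k, K i k -> row i (x k.+1) = mix (fun j => row j (x (s i j k))) i) ->
  (forall i k, ~ K i k -> row i (x k.+1) = row i (x k)) ->
  xs = F xs ->
  x k @[k --> \oo] --> xs.
Proof.
move=> Kinf sle soo xK xNK xsF; case/andP: (r01) => r0 r1.
have [C xC] := async_geometric_bound Kinf sle soo xK xNK xsF.
apply/cvgrPdist_le => eps eps0.
(* [eps] is squared because the geometric bound is on squared distances, which dominate squared
   entries. *)
have [m rm] : exists m, r ^+ m * C <= eps ^+ 2.
  have := @cvg_geometric R C r; rewrite ger0_norm// => /(_ r1).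
  move/cvgrPdist_le => /(_ _ (exprn_gt0 2 eps0))[m _ rm].
  exists m; have := rm m (leqnn m).
  by rewrite /= sub0r normrN mulrC; apply: le_trans; exact: ler_norm.
apply: filterS (xC m) => k xk; apply/mx_norm_leP => [|i j]; first exact: ltW.
rewrite -ler_sqr ?nnegrE ?(ltW eps0)// real_normK ?num_real// -sqrrN.
have -> : - (xs - x k) i j = (row i (x k) - row i xs) 0 j by rewrite !mxE opprB.
exact: le_trans (sqr_entry_le_dotp _ _) (le_trans (xk i) rm).
Qed.

End BlockContraction.

(** * Application to DGD-ATC *)

Theorem theorem5 (R : realType) (n d : nat) (n_gt0 : (0 < n)%N)
    (e : rel 'I_n) (W : 'M[R]_n) (f : 'I_n -> 'rV[R]_d -> R)
    (L mu : 'I_n -> R) (alpha : R)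
    (K : 'I_n -> set nat) (s : 'I_n -> 'I_n -> nat -> nat) :
  connected_graph e ->
  posdef_mx W ->
  averaging_matrix e W ->
  admissible_delays e s ->
  (forall i, [/\ convex_function setT (f i), 0 < L i, smooth (L i) (f i)
               & has_lbound (range (f i))]) ->
  minimizers (fun x : 'rV[R]_d => \sum_(i < n) f i x) !=set0 ->
  bounded_set (minimizers (fun x : 'rV[R]_d => \sum_(i < n) f i x)) ->
  (forall i, 0 < mu i /\ strongly_convex (mu i) (f i)) ->
  totally_asynchronous e K s ->
  0 < alpha < 2 / \big[Num.max/0]_(i < n) L i ->
  forall (x0 : 'M[R]_(n, d)) (x : nat -> 'M[R]_(n, d)),
    x 0%N = x0 ->
    async_DGD_ATC e W alpha f K s x ->
    exists xs : 'M[R]_(n, d),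
      sync_fixed_point W alpha f xs /\ x k @[k --> \oo] --> xs.
Proof.
move=> _ _ [W0 W1 _ _ We] [sle sii] fsmooth _ _ fmu [Kinf soo] /andP[a0 aL] _ x _ xs_async.
have aL2 i : alpha * L i < 2.
  have [_ Li _ _] := fsmooth i.
  have LM : L i <= \big[Num.max/0]_(j < n) L j := le_bigmax _ _ i.
  rewrite ltr_pdivlMr in aL; last exact: lt_le_trans LM.
  by apply: le_lt_trans aL; rewrite ler_pM2l.
pose T j (y : 'rV[R]_d) := y - alpha *: grad (f j) y.
have [r r01 Tr] : exists2 r, 0 <= r < 1 & forall j y z,
    dotp (T j z - T j y) (T j z - T j y) <= r * dotp (z - y) (z - y).
  pose q j := 1 - alpha * (2 - alpha * L j) * mu j.
  (* The default value 0 yields [0 <= r] whatever the signs of the [q j]; each [q j] is below 1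
     because [alpha * L j < 2]. *)
  exists (\big[Num.max/0]_j q j) => [|j y z].
    rewrite bigmax_ge_id; apply/bigmax_ltP; split=> // j _.
    by rewrite ltrBlDr ltrDl !mulr_gt0 ?subr_gt0//; have [] := fmu j.
  have [_ Lj fL _] := fsmooth j; have [muj fconv] := fmu j.
  apply: le_trans (gradient_step_contraction _ Lj muj (ltW a0) (ltW (aL2 j))
    fL fconv y z) _; first by case: fL.
  by rewrite ler_wpM2r ?dotp_ge0// (le_bigmax _ q).
(* Turns the delay conditions, given along edges, into conditions on nonzero weights; the diagonal
   is covered by [s i i k = k]. *)
have Wnbh i j : W i j != 0 -> e i j \/ i = j.
  move=> Wij; have [eij|neij] := boolP (e i j || (i == j)).
    by case/orP: eij => [|/eqP]; [left|right].
  by rewrite We ?eqxx in Wij.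
have [xs xsF] := block_contraction_fixed_point W0 W1 r01 Tr.
exists xs; split.
  rewrite /sync_fixed_point {1}xsF; apply/row_matrixP => i.
  rewrite rowK row_mul mulmx_sum_row; apply: eq_bigr => j _.
  rewrite mxE; congr (_ *: _).
  by rewrite [RHS]linearB linearZ/= row_grad_total_cost.
apply: (@async_iterates_cvg _ _ _ _ _ _ W0 W1 r01 Tr _ s x xs Kinf _ _ _ _ xsF)
  => [i j k|i j|i k|i k].
- by move/Wnbh => [/sle//|<-]; rewrite sii.
- move/Wnbh => [/soo//|<-].
  by rewrite (_ : s i i = id)//; apply/funext => k; exact: sii.
- move=> Kik; rewrite (xs_async i k).1//.
  (* The sum over the closed neighbourhood extends to all nodes because the weights vanish outside
     it. *)
  rewrite big_mkcond; apply: eq_bigr => j _; case: ifPn => // jnbh.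
  rewrite We ?scale0r//; apply: contra jnbh.
  by rewrite !inE eq_sym.
- exact: (xs_async i k).2.
Qed.
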